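(* Let $a=(a_n)_{n=1}^\infty$ be a non-increasing sequence with $0<a_n<1$ for every $n$, and let $\mathbb{M}^a$ be the associated dyadic slit carpet. If $\mathbb{M}^a$ admits a bi-Lipschitz embedding into some Euclidean space $\mathbb{R}^N$, then $a\in\ell_{1+\epsilon}$ (i.e. $\sum_n a_n^{1+\epsilon}<\infty$) for every $\epsilon>0$.
   Context: A map $f:(X,d_X)\to(Y,d_Y)$ is a bi-Lipschitz embedding if there are constants $0<c\le C$ with $c\,d_X(x,y)\le d_Y(f(x),f(y))\le C\,d_X(x,y)$ for all $x,y\in X$. Construction of $\mathbb{M}^a$: for each $n\ge1$ and each dyadic square $Q=[l2^{-n},(l+1)2^{-n}]\times[k2^{-n},(k+1)2^{-n}]\subset[0,1]^2$ ($0\le l,k\le 2^n-1$), remove from $[0,1]^2$ the closed vertical segment (slit) of length $a_n2^{-n-1}$ whose midpoint is the center of $Q$. Equip the set remaining after all these removals with its path metric (infimum of Euclidean lengths of paths in the remaining set), and let $\mathbb{M}^a$ be the metric completion. *)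

(* Defs.v *)
From HB Require Import structures.
From mathcomp Require Import all_boot all_order all_algebra.
From mathcomp Require Import all_classical all_reals all_analysis.

Set Implicit Arguments.
Unset Strict Implicit.
Unset Printing Implicit Defensive.

Import Order.TTheory GRing.Theory Num.Theory.
Import numFieldNormedType.Exports.

Local Open Scope classical_set_scope.
Local Open Scope ring_scope.

(* The library norm on 'rV[R]_N is the sup norm, hence a separate Euclidean
   distance; the two induce the same topology, so continuity of curves is
   unaffected. *)
Definition eucl_dist {R : realType} {N : nat} (p q : 'rV[R]_N) : R :=
  Num.sqrt (\sum_(i < N) (p 0 i - q 0 i) ^+ 2).

(* Analogue of total_variation for curves in 'rV[R]_N: itv_partition a b s
   says that a :: s increases strictly from a to b. *)
Definition curve_length {R : realType} {N : nat} (a b : R)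
    (gamma : R -> 'rV[R]_N) : \bar R :=
  ereal_sup [set (\sum_(0 <= j < size s)
      eucl_dist (gamma (nth b (a :: s) j)) (gamma (nth b (a :: s) j.+1)))%:E
    | s in [set s : seq R | itv_partition a b s]].

Definition is_path_in {R : realType} {N : nat} (S : set 'rV[R]_N)
    (p q : 'rV[R]_N) (gamma : R -> 'rV[R]_N) : Prop :=
  [/\ {within `[0%R, 1%R], continuous gamma},
      gamma 0 = p, gamma 1 = q
    & forall t, 0 <= t <= 1 -> S (gamma t)].

(* Equal to +oo when no rectifiable path in S joins p to q. *)
Definition path_dist {R : realType} {N : nat} (S : set 'rV[R]_N)
    (p q : 'rV[R]_N) : \bar R :=
  ereal_inf [set curve_length 0 1 gamma | gamma in is_path_in S p q].

Section slit_carpet.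
Context {R : realType}.
Implicit Types (a : nat -> R) (n l k : nat) (p : 'rV[R]_2).

Definition xcoord p : R := p ord0 ord0.
Definition ycoord p : R := p ord0 ord_max.

Definition unit_square : set 'rV[R]_2 :=
  [set p | 0 <= xcoord p <= 1 /\ 0 <= ycoord p <= 1].

Definition dyadic_center n l : R := (l%:R + 2^-1) / 2 ^+ n.

(* The slit of the square of indices n, l, k is a vertical segment of length
   a n / 2 ^+ n.+1 about the centre of the square. *)
Definition slit a n l k : set 'rV[R]_2 :=
  [set p | xcoord p = dyadic_center n l /\
           `|ycoord p - dyadic_center n k| <= (a n / 2 ^+ n.+1) / 2].

(* The value a 0 is never used: the sequence starts at index 1. *)
Definition slit_domain a : set 'rV[R]_2 :=
  [set p | unit_square p /\
    forall n l k, (1 <= n)%N -> (l < 2 ^ n)%N -> (k < 2 ^ n)%N ->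
      ~ slit a n l k p].

End slit_carpet.

Definition complete_metric {R : realType} (M : metricType R) : Prop :=
  forall F : set_system M, ProperFilter F -> cauchy F ->
    exists x : M, F --> x.

(* (M, iota) is the metric completion of the set S with distance d. Completions
   are unique up to isometry. Only the values of iota on S matter; in
   particular d must be finite on S. *)
Definition is_metric_completion {R : realType} {T : Type} (S : set T)
    (d : T -> T -> \bar R) (M : metricType R) (iota : T -> M) : Prop :=
  [/\ complete_metric M,
      forall x y, S x -> S y -> (mdist (iota x) (iota y))%:E = d x y
    & dense (iota @` S)].

Definition is_dyadic_slit_carpet {R : realType} (a : nat -> R)
    (M : metricType R) : Prop :=
  exists iota : 'rV[R]_2 -> M,
    is_metric_completion (slit_domain a) (path_dist (slit_domain a)) iota.

Definition bilipschitz_embedding {R : realType} {M : metricType R} {N : nat}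
    (f : M -> 'rV[R]_N) : Prop :=
  exists c C : R, [/\ 0 < c, c <= C &
    forall x y : M, c * mdist x y <= eucl_dist (f x) (f y) <= C * mdist x y].

(* Main.v *)
(** Call edge pair of level n the two midpoints of the horizontal sides of a
dyadic square of side s = 2^-n, and V the stretch |f(B) - f(A)| / s of such a
pair under the embedding f.  The segment AB is cut by the slit of the square.
Subdivide into K pieces, K a_n large, following the centre lines of the two
columns of width s/K on either side of AB; the pieces are again edge pairs.  At
the slit, the two sides start and end at nearly the same points while their
middles are at distance of order a_n s, so by the parallelogram law one of the
sides makes a genuine detour in Euclidean space.  Hence some edge pair of level
n + log2 K has stretch at least V + theta, with theta of order a_n.  The stretch
is bounded by the Lipschitz constant, so n a_n / log(1/a_n) is bounded, and
Cauchy condensation concludes. *)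

Require Import Defs.
From HB Require Import structures.
From mathcomp Require Import all_boot all_order all_algebra.
From mathcomp Require Import all_classical all_reals all_analysis.
From mathcomp Require Import ring lra zify.
Import Order.TTheory GRing.Theory Num.Theory.
Import numFieldNormedType.Exports.
Local Open Scope classical_set_scope.
Local Open Scope ring_scope.

(** * Euclidean norm, parallelogram law and hinges *)

Section euclidean_norm.
Context {R : realType} {N : nat}.
Implicit Types u v w p q : 'rV[R]_N.

Definition enorm u : R := Num.sqrt (\sum_(i < N) u 0 i ^+ 2).

Lemma eucl_dist_enorm p q : eucl_dist p q = enorm (p - q).
Proof. by congr Num.sqrt; apply: eq_bigr => i _; rewrite !mxE. Qed.

Lemma sqr_sum_ge0 u : 0 <= \sum_(i < N) u 0 i ^+ 2.
Proof. by apply: sumr_ge0 => i _; exact: sqr_ge0. Qed.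

Lemma enorm_ge0 u : 0 <= enorm u. Proof. exact: sqrtr_ge0. Qed.

Lemma sqr_enorm u : enorm u ^+ 2 = \sum_(i < N) u 0 i ^+ 2.
Proof. by rewrite sqr_sqrtr // sqr_sum_ge0. Qed.

Lemma enorm0 : enorm 0 = 0.
Proof.
apply/eqP; rewrite sqrtr_eq0 big1 // => i _; by rewrite !mxE expr0n.
Qed.

Lemma enormZ (t : R) u : 0 <= t -> enorm (t *: u) = t * enorm u.
Proof.
move=> t0; rewrite /enorm -[X in X * _](ger0_norm t0) -sqrtr_sqr.
rewrite -sqrtrM ?sqr_ge0 // mulr_sumr.
by congr Num.sqrt; apply: eq_bigr => i _; rewrite mxE exprMn.
Qed.

Lemma enormN u : enorm (- u) = enorm u.
Proof. by congr Num.sqrt; apply: eq_bigr => i _; rewrite mxE sqrrN. Qed.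

Lemma enorm_eq0_entry u i : enorm u = 0 -> u 0 i = 0.
Proof.
move=> /eqP; rewrite sqrtr_eq0 => h.
have {h}/eqP : \sum_(i < N) u 0 i ^+ 2 = 0.
  by apply/eqP; rewrite eq_le h sqr_sum_ge0.
rewrite psumr_eq0; last by move=> j _; exact: sqr_ge0.
by move=> /allP /(_ i); rewrite mem_index_enum sqrf_eq0 => /(_ isT) /eqP.
Qed.

(** Summing [(enorm v * u_i - enorm u * v_i) ^ 2 >= 0] over [i] gives the inequality multiplied by
    [2 * enorm u * enorm v]; the degenerate cases are split off so that this factor can be
    cancelled. *)
Lemma cauchy_schwarz u v : \sum_(i < N) u 0 i * v 0 i <= enorm u * enorm v.
Proof.
have [u0|u_neq0] := eqVneq (enorm u) 0.
  by rewrite u0 mul0r big1 // => i _; rewrite (enorm_eq0_entry _ i u0) mul0r.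
have [v0|v_neq0] := eqVneq (enorm v) 0.
  by rewrite v0 mulr0 big1 // => i _; rewrite (enorm_eq0_entry _ i v0) mulr0.
have u_gt0 : 0 < enorm u by rewrite lt_def u_neq0 enorm_ge0.
have v_gt0 : 0 < enorm v by rewrite lt_def v_neq0 enorm_ge0.
have {u_neq0 v_neq0} : 2 * (enorm u * enorm v) * (\sum_(i < N) u 0 i * v 0 i)
    <= enorm v ^+ 2 * enorm u ^+ 2 + enorm u ^+ 2 * enorm v ^+ 2.
  rewrite {1}[enorm u ^+ 2]sqr_enorm {2}[enorm v ^+ 2]sqr_enorm.
  rewrite !mulr_sumr -big_split /=; apply: ler_sum => i _.
  have := sqr_ge0 (enorm v * u 0 i - enorm u * v 0 i); nra.
have uv_gt0 : 0 < enorm u * enorm v by rewrite mulr_gt0.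
set S := \sum_(i < N) _ => h.
rewrite -(ler_pM2l (mulr_gt0 (ltr0Sn R 1) uv_gt0)); nra.
Qed.

Lemma enormD u v : enorm (u + v) <= enorm u + enorm v.
Proof.
rewrite -(@ler_pXn2r _ 2) ?nnegrE ?addr_ge0 ?enorm_ge0 //.
rewrite sqrrD !sqr_enorm.
have -> : \sum_(i < N) (u + v) 0 i ^+ 2 = \sum_(i < N) u 0 i ^+ 2 +
    (\sum_(i < N) u 0 i * v 0 i) *+ 2 + \sum_(i < N) v 0 i ^+ 2.
  rewrite -sumrMnl -!big_split /=; apply: eq_bigr => i _.
  by rewrite mxE sqrrD.
by rewrite lerD2r lerD2l lerMn2r cauchy_schwarz orbT.
Qed.

Lemma enormB u v : enorm (u - v) <= enorm u + enorm v.
Proof. by rewrite (le_trans (enormD _ _)) // enormN. Qed.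

Lemma parallelogram_law u v :
  enorm (u + v) ^+ 2 + enorm (u - v) ^+ 2 = 2 * (enorm u ^+ 2 + enorm v ^+ 2).
Proof.
rewrite !sqr_enorm -!big_split /= mulr_sumr; apply: eq_bigr => i _.
rewrite !mxE; ring.
Qed.

Lemma enorm_sum (u : nat -> 'rV[R]_N) (U : R) (m n : nat) : (m <= n)%N ->
  (forall i, (m <= i < n)%N -> enorm (u i.+1 - u i) <= U) ->
  enorm (u n - u m) <= U * (n - m)%N%:R.
Proof.
move=> mn hu; rewrite -(@telescope_sumr _ m n u) //.
have -> : U * (n - m)%N%:R = \sum_(m <= i < n) U.
  by rewrite sumr_const_nat mulr_natr.
rewrite big_nat [leRHS]big_nat.
elim/big_ind2 : _ => [|x1 y1 x2 y2 h1 h2|i hi]; rewrite ?enorm0 //.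
- by rewrite (le_trans (enormD _ _)) // lerD.
- exact: hu.
Qed.

(* If both ends of two hinges of arm length W nearly coincide while their
   middles are D apart, then one of the middles is (D - e)/2 away from the
   midpoint of the ends of its hinge, which the parallelogram law turns into a
   shortening of the base of that hinge. *)
Lemma double_hinge (W D e : R) (p m q p' m' q' : 'rV[R]_N) :
  enorm (m - q) <= W -> enorm (p - m) <= W ->
  enorm (m' - q') <= W -> enorm (p' - m') <= W ->
  enorm (p - p') <= e -> enorm (q - q') <= e -> D <= enorm (m - m') ->
  e <= D ->
  enorm (p - q) ^+ 2 <= 4 * W ^+ 2 - (D - e) ^+ 2 \/
  enorm (p' - q') ^+ 2 <= 4 * W ^+ 2 - (D - e) ^+ 2.
Proof.
have bend r s t : enorm (s - t) <= W -> enorm (r - s) <= W ->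
    4 * W ^+ 2 - (D - e) ^+ 2 < enorm (r - t) ^+ 2 -> e <= D ->
    enorm ((s - t) - (r - s)) < D - e.
  move=> h1 h2 h3 eD; have := parallelogram_law (s - t) (r - s).
  have -> : s - t + (r - s) = r - t by rewrite addrC addrA subrK.
  have h4 : enorm (s - t) ^+ 2 <= W ^+ 2.
    by rewrite ler_pXn2r // nnegrE ?(le_trans _ h1) ?enorm_ge0.
  have h5 : enorm (r - s) ^+ 2 <= W ^+ 2.
    by rewrite ler_pXn2r // nnegrE ?(le_trans _ h1) ?enorm_ge0.
  move=> h6; rewrite -(@ltr_pXn2r _ 2) ?nnegrE ?enorm_ge0 ?subr_ge0 //; nra.
move=> h1 h2 h3 h4 h5 h6 h7 eD; apply/orP; rewrite -implyNb -ltNge.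
apply/implyP => h8; rewrite leNgt; apply/negP => h9.
have b1 := bend _ _ _ h1 h2 h8 eD.
have b2 := bend _ _ _ h3 h4 h9 eD.
have : 2 * enorm (m - m') <= enorm (m - q - (p - m)) +
    enorm (m' - q' - (p' - m')) + (enorm (p - p') + enorm (q - q')).
  rewrite -enormZ //.
  (* Twice the gap of the middles is the difference of the two second differences plus the two end
     gaps. If neither base were shortened, [bend] would make this smaller than
     [2 * (D - e) + 2 * e]. *)
  have -> : 2 *: (m - m') = (m - q - (p - m)) - (m' - q' - (p' - m')) +
      ((p - p') + (q - q')).
    by apply/rowP => i; rewrite !mxE; ring.
  by rewrite (le_trans (enormD _ _)) // lerD ?enormD ?enormB.
lra.
Qed.

End euclidean_norm.

(** * Curve length and path distance *)

Section path_metric.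
Context {R : realType} {N : nat}.
Implicit Types (S : set 'rV[R]_N) (p q : 'rV[R]_N).

(** Chords of an affine curve are proportional to the parameter increments, so every partition sum
    telescopes to the same value. *)
Lemma curve_length_segment p q :
  (curve_length 0 1 (fun t : R => p + t *: (q - p))%R <= (eucl_dist p q)%:E)%E.
Proof.
apply: ge_ereal_sup => _ [s s01 <-]; rewrite lee_fin.
have [s_path _] := s01.
rewrite big_nat (eq_bigr (fun j => (nth 1 (0 :: s) j.+1 - nth 1 (0 :: s) j) *
  eucl_dist p q)); last first.
  move=> j /andP[_ js]; rewrite !eucl_dist_enorm -[enorm (p - q)]enormN opprB.
  rewrite -enormZ; last by rewrite subr_ge0 ltW //; exact: (pathP 1 s_path).
  rewrite -enormN; congr enorm; apply/rowP => i; rewrite !mxE; ring.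
rewrite -big_nat -mulr_suml telescope_sumr // (itv_partition_nth_size _ s01).
by rewrite subr0 mul1r.
Qed.

Lemma path_dist_segment S p q :
  (forall t : R, 0 <= t <= 1 -> S (p + t *: (q - p))) ->
  (path_dist S p q <= (eucl_dist p q)%:E)%E.
Proof.
move=> hS; apply: le_trans (curve_length_segment p q).
apply: ereal_inf_lbound; exists (fun t : R => p + t *: (q - p)) => //; split => //.
- apply: continuous_subspaceT => t; apply: cvgD; first exact: cvg_cst.
  by apply: cvgZr_tmp; exact: cvg_id.
- by rewrite scale0r addr0.
- by rewrite scale1r addrC subrK.
Qed.

Lemma curve_length_ge_via p q (gamma : R -> 'rV[R]_N) (t : R) : 0 < t < 1 ->
  gamma 0 = p -> gamma 1 = q ->
  ((eucl_dist p (gamma t) + eucl_dist (gamma t) q)%:E <=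
    curve_length 0 1 gamma)%E.
Proof.
move=> /andP[t0 t1] g0 g1; apply: ereal_sup_ubound.
exists [:: t; 1]; first by split; rewrite /= ?t0 ?t1 ?eqxx.
by rewrite /= big_nat_recl // big_nat1 /= g0 g1.
Qed.

End path_metric.

(** * Dyadic grids, slits, and points of the slit domain *)

Section plane.
Context {R : realType}.
Implicit Types (x y : R) (a : nat -> R).

Definition pt x y : 'rV[R]_2 := \row_j (if j == ord0 then x else y).

Lemma xcoord_pt x y : xcoord (pt x y) = x.
Proof. by rewrite /xcoord mxE. Qed.

Lemma ycoord_pt x y : ycoord (pt x y) = y.
Proof. by rewrite /ycoord mxE. Qed.

Lemma eucl_dist2 (p q : 'rV[R]_2) : eucl_dist p q =
  Num.sqrt ((xcoord p - xcoord q) ^+ 2 + (ycoord p - ycoord q) ^+ 2).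
Proof.
rewrite /eucl_dist big_ord_recl big_ord1 /xcoord /ycoord.
by rewrite (_ : lift ord0 ord0 = ord_max) //; exact: val_inj.
Qed.

Lemma eucl_dist_horizontal x x' y : eucl_dist (pt x y) (pt x' y) = `|x - x'|.
Proof.
by rewrite eucl_dist2 !xcoord_pt !ycoord_pt subrr expr0n addr0 sqrtr_sqr.
Qed.

Lemma eucl_dist_vertical x y y' : eucl_dist (pt x y) (pt x y') = `|y - y'|.
Proof.
by rewrite eucl_dist2 !xcoord_pt !ycoord_pt subrr expr0n add0r sqrtr_sqr.
Qed.

Lemma ycoord_le_eucl_dist (p q : 'rV[R]_2) :
  `|ycoord p - ycoord q| <= eucl_dist p q.
Proof.
by rewrite eucl_dist2 -sqrtr_sqr ler_wsqrtr // lerDr sqr_ge0.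
Qed.

Lemma pow2_gt0 n : 0 < 2 ^+ n :> R. Proof. by rewrite exprn_gt0. Qed.

Lemma half_int_dist (i k : nat) : 2^-1 <= `|i%:R - (k%:R + 2^-1)| :> R.
Proof.
have [ik|ki] := leqP i k.
  have : (i%:R <= k%:R :> R) by rewrite ler_nat.
  by move=> h; rewrite ler_normr; apply/orP; right; lra.
have : (k.+1%:R <= i%:R :> R) by rewrite ler_nat.
by rewrite -natr1 => h; rewrite ler_normr; apply/orP; left; lra.
Qed.

(** After scaling by [2 ^ n] the grid coordinate is an integer and the centre is a half-integer. *)
Lemma grid_center_dist (i m n k : nat) : (m <= n)%N ->
  2^-1 / 2 ^+ n <= `|i%:R / 2 ^+ m - dyadic_center n k| :> R.
Proof.
move=> mn; rewrite /dyadic_center.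
have -> : i%:R / 2 ^+ m = (i * 2 ^ (n - m))%N%:R / 2 ^+ n :> R.
  rewrite natrM natrX -{2}(subnK mn) exprD invfM mulrA.
  by rewrite -(mulrA i%:R) divff ?mulr1 // expf_neq0.
rewrite -mulrBl normrM [X in _ <= _ * X]gtr0_norm ?invr_gt0 ?pow2_gt0 //.
by rewrite ler_pM2r ?invr_gt0 ?pow2_gt0 // half_int_dist.
Qed.

Lemma center_grid (m l : nat) :
  dyadic_center m l = (2 * l + 1)%N%:R / 2 ^+ m.+1 :> R.
Proof.
have := pow2_gt0 m => h.
rewrite /dyadic_center natrD natrM exprS; field; lra.
Qed.

Lemma center_center_dist (m n k l : nat) : (m < n)%N ->
  2^-1 / 2 ^+ n <= `|dyadic_center m l - dyadic_center n k| :> R.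
Proof. by move=> mn; rewrite center_grid grid_center_dist. Qed.

(** The two lines half a fine width away from a coarse centre line are themselves centre lines of
    fine columns, so the pieces of the two side chains are edge pairs of the finer level. The
    boolean picks the right or left neighbour; the left index is smaller by one. *)
Lemma center_col (n k m : nat) (b : bool) :
  dyadic_center n k + (if b then 1 else -1) * (2^-1 / 2 ^+ (n + m.+1)) =
  dyadic_center (n + m.+1) ((2 * k + 1) * 2 ^ m - (~~ b))%N :> R.
Proof.
have hn := pow2_gt0 n; have hm := pow2_gt0 m.
have kpos : (~~ b <= (2 * k + 1) * 2 ^ m)%N.
  by rewrite (leq_trans (leq_b1 _)) // muln_gt0 addn1 expn_gt0.
rewrite /dyadic_center natrB // natrM natrD natrM natrX exprD exprS.
case: b {kpos} => /=; field; lra.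
Qed.

Lemma center_col_lt (n k m : nat) (b : bool) : (k < 2 ^ n)%N ->
  ((2 * k + 1) * 2 ^ m - (~~ b) < 2 ^ (n + m.+1))%N.
Proof.
move=> kn; rewrite (leq_ltn_trans (leq_subr _ _)) // [(n + _)%N]addnS expnS expnD mulnA.
by rewrite ltn_pmul2r ?expn_gt0 //; lia.
Qed.

Lemma unit_square_col (n l : nat) x y : (l < 2 ^ n)%N ->
  `|x - dyadic_center n l| <= 2^-1 / 2 ^+ n -> 0 <= y <= 1 ->
  unit_square (pt x y).
Proof.
move=> ln; rewrite ler_distl /unit_square /= xcoord_pt ycoord_pt => h ->.
split=> //; move: h; rewrite /dyadic_center -mulrBl -mulrDl => /andP[h1 h2].
rewrite (le_trans _ h1) /=; last first.
  by rewrite addrK divr_ge0 ?ler0n // ltW ?pow2_gt0.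
rewrite (le_trans h2) // ler_pdivrMr ?pow2_gt0 // mul1r.
have : (l.+1%:R <= 2 ^+ n :> R) by rewrite -natrX ler_nat.
by rewrite -natr1; lra.
Qed.

(** Slits of a coarser level lie on grid lines of level [m.+1 <= n], hence never inside an open
    column of level [n]. *)
Lemma slit_off_column a (n l m l' k' : nat) x y : (m < n)%N ->
  `|x - dyadic_center n l| < 2^-1 / 2 ^+ n -> ~ slit a m l' k' (pt x y).
Proof.
move=> mn h [/= xc _]; move: h; rewrite xcoord_pt in xc.
by rewrite xc ltNge center_center_dist.
Qed.

(** A slit reaches less than a quarter of the side above and below its centre, while grid heights
    stay half a side away from the centre. *)
Lemma slit_off_grid a (n m i l k : nat) x : a m < 1 -> (n <= m)%N ->
  ~ slit a m l k (pt x (i%:R / 2 ^+ n)).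
Proof.
move=> am nm [/= _]; rewrite ycoord_pt; apply/negP; rewrite -ltNge.
apply: lt_le_trans (grid_center_dist i _ _ k nm).
have := pow2_gt0 m => h.
have -> : a m / 2 ^+ m.+1 / 2 = a m / 4 / 2 ^+ m by rewrite exprS; field; lra.
rewrite ltr_pM2r ?invr_gt0 //; lra.
Qed.

(* At heights of the grid of level n', the only slits near the centre line of
   a dyadic column of level n < n' are those on the line itself. *)
Lemma crossing_in_domain a (n n' l i : nat) x :
  (forall m, (1 <= m)%N -> a m < 1) ->
  (n < n')%N -> (l < 2 ^ n)%N -> (i <= 2 ^ n')%N ->
  `|x - dyadic_center n l| <= 2^-1 / 2 ^+ n' ->
  (forall k, (a n / 2 ^+ n.+1) / 2 < `|i%:R / 2 ^+ n' - dyadic_center n k|) ->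
  slit_domain a (pt x (i%:R / 2 ^+ n')).
Proof.
move=> a1 nn' ln hi hx hy.
have hx1 : `|x - dyadic_center n l| < 2^-1 / 2 ^+ n.
  rewrite (le_lt_trans hx) // ltr_pM2l ?invr_gt0 // ltf_pV2 ?posrE ?pow2_gt0 //.
  by rewrite ltr_eXn2l // ltr1n.
split.
  apply: unit_square_col ln (ltW hx1) _.
  rewrite divr_ge0 ?ler0n ?(ltW (pow2_gt0 _)) //=.
  by rewrite ler_pdivrMr ?pow2_gt0 // mul1r -natrX ler_nat.
move=> m l' k' m1 _ _.
have [mn|nm|->] := ltngtP m n; first exact: slit_off_column hx1.
- have [n'm|mn'] := leqP n' m; first by apply: slit_off_grid => //; exact: a1.
  (* For [n < m < n'] the slit abscissas are at least [2^-1 / 2 ^+ m] from the centre line of level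
     [n], farther than [x] is. *)
  move=> [/= xc _]; rewrite xcoord_pt in xc; move: hx; apply/negP.
  rewrite -ltNge xc distrC.
  apply: lt_le_trans (center_center_dist _ _ _ _ nm).
  by rewrite ltr_pM2l ?invr_gt0 // ltf_pV2 ?posrE ?pow2_gt0 // ltr_eXn2l ?ltr1n.
- move=> [/= _]; rewrite ycoord_pt; apply/negP; rewrite -ltNge; exact: hy.
Qed.

Lemma grid_in_domain a (n l i : nat) x :
  (forall m, (1 <= m)%N -> a m < 1) ->
  (l < 2 ^ n)%N -> (i <= 2 ^ n)%N ->
  `|x - dyadic_center n l| < 2^-1 / 2 ^+ n ->
  slit_domain a (pt x (i%:R / 2 ^+ n)).
Proof.
move=> a1 ln hi hx; split.
  apply: unit_square_col ln (ltW hx) _.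
  rewrite divr_ge0 ?ler0n ?(ltW (pow2_gt0 _)) //=.
  by rewrite ler_pdivrMr ?pow2_gt0 // mul1r -natrX ler_nat.
move=> m l' k' m1 _ _; have [nm|mn] := leqP n m.
  by apply: slit_off_grid => //; exact: a1.
exact: slit_off_column hx.
Qed.

(* The offset of a third makes the abscissa non-dyadic. *)
Lemma third_line_in_domain a (n l : nat) y :
  (l < 2 ^ n)%N -> 0 <= y <= 1 ->
  slit_domain a (pt (dyadic_center n l + 3^-1 / 2 ^+ n) y).
Proof.
move=> ln y01; have n0 := pow2_gt0 n; split.
  apply: unit_square_col ln _ y01; rewrite addrAC subrr add0r ger0_norm.
    by rewrite ler_pM2r ?invr_gt0 //; lra.
  by rewrite divr_ge0 // ltW.
move=> m l' k' _ _ _ [/= xc _]; move: xc; rewrite xcoord_pt (center_grid m).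
have m0 := pow2_gt0 m.+1.
rewrite /dyadic_center -mulrDl => /eqP.
rewrite eqr_div ?lt0r_neq0 // => /eqP xc.
(* Since [1/2 + 1/3 = 5/6], clearing denominators gives an equation whose right side is divisible by
   3, whereas 3 divides neither [6 * l + 5] nor a power of 2. *)
have : ((6 * l + 5) * 2 ^ m.+1)%N%:R = (3 * (2 * (2 * l' + 1) * 2 ^ n))%N%:R :> R.
  move: xc; rewrite !(natrM, natrD, natrX) => xc; nra.
move=> /eqP; rewrite eqr_nat => /eqP h.
have : (3 %| (6 * l + 5) * 2 ^ m.+1)%N by rewrite h dvdn_mulr.
rewrite Euclid_dvdM // Euclid_dvdX // andbC /= orbF.
by rewrite dvdn_addr // -[6%N]/(3 * 2)%N -mulnA dvdn_mulr.
Qed.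

End plane.

(** * Distance estimates in the carpet *)

Section carpet_metric.
Context {R : realType} {a : nat -> R} {M : metricType R} {iota : 'rV[R]_2 -> M}.
Context (a_bounds : forall n : nat, (1 <= n)%N -> 0 < a n < 1).
Context (iota_dist : forall p q, slit_domain a p -> slit_domain a q ->
  (mdist (iota p) (iota q))%:E = path_dist (slit_domain a) p q).

Let a_lt1 m : (1 <= m)%N -> a m < 1.
Proof. by move=> /a_bounds /andP[]. Qed.

Lemma mdist_segment (p q : 'rV[R]_2) :
  (forall t : R, 0 <= t <= 1 -> slit_domain a (p + t *: (q - p))) ->
  mdist (iota p) (iota q) <= eucl_dist p q.
Proof.
move=> hS; rewrite -lee_fin iota_dist; first exact: path_dist_segment.
- by have := hS 0; rewrite scale0r addr0 lexx ler01; apply.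
- by have := hS 1; rewrite scale1r addrC subrK lexx ler01; apply.
Qed.

Lemma mdist_horizontal (x x' y : R) : x <= x' ->
  (forall z, x <= z <= x' -> slit_domain a (pt z y)) ->
  mdist (iota (pt x y)) (iota (pt x' y)) <= x' - x.
Proof.
move=> xx' hS; rewrite -(ger0_norm (_ : 0 <= x' - x)) ?subr_ge0 // distrC.
rewrite -(eucl_dist_horizontal _ _ y); apply: mdist_segment => t /andP[t0 t1].
have -> : pt x y + t *: (pt x' y - pt x y) = pt (x + t * (x' - x)) y.
  by apply/rowP => i; rewrite !mxE; case: eqP => _ //; ring.
by apply: hS; nra.
Qed.

Lemma mdist_vertical (x y y' : R) : y <= y' ->
  (forall z, y <= z <= y' -> slit_domain a (pt x z)) ->
  mdist (iota (pt x y)) (iota (pt x y')) <= y' - y.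
Proof.
move=> yy' hS; rewrite -(ger0_norm (_ : 0 <= y' - y)) ?subr_ge0 // distrC.
rewrite -(eucl_dist_vertical x); apply: mdist_segment => t /andP[t0 t1].
have -> : pt x y + t *: (pt x y' - pt x y) = pt x (y + t * (y' - y)).
  by apply/rowP => i; rewrite !mxE; case: eqP => _ //; ring.
by apply: hS; nra.
Qed.

Lemma mdist_crossing (n n' l i : nat) (x x' : R) :
  (n < n')%N -> (l < 2 ^ n)%N -> (i <= 2 ^ n')%N ->
  dyadic_center n l - 2^-1 / 2 ^+ n' <= x -> x <= x' ->
  x' <= dyadic_center n l + 2^-1 / 2 ^+ n' ->
  (forall k, (a n / 2 ^+ n.+1) / 2 < `|i%:R / 2 ^+ n' - dyadic_center n k|) ->
  mdist (iota (pt x (i%:R / 2 ^+ n'))) (iota (pt x' (i%:R / 2 ^+ n'))) <= x' - x.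
Proof.
move=> nn' ln hi hx xx' hx' hy; apply: mdist_horizontal => // z /andP[xz zx'].
apply: (crossing_in_domain _ n n' l) => //.
by rewrite ler_distl (le_trans hx xz) (le_trans zx' hx').
Qed.

(** The direct segment meets the slit, so the path steps sideways by a third of the side, climbs
    along a line free of slits, and steps back: [1/3 + 1 + 1/3 <= 2] sides. *)
Lemma mdist_edge_midpoints (n l i : nat) : (l < 2 ^ n)%N -> (i < 2 ^ n)%N ->
  mdist (iota (pt (dyadic_center n l) (i%:R / 2 ^+ n)))
        (iota (pt (dyadic_center n l) (i.+1%:R / 2 ^+ n))) <= 2 / 2 ^+ n.
Proof.
move=> ln hi; have n0 := pow2_gt0 (R := R) n.
set c := dyadic_center n l; set c' := c + 3^-1 / 2 ^+ n.
have cc' : c <= c' by rewrite lerDl divr_ge0 // ltW.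
have side j : (j <= 2 ^ n)%N -> mdist (iota (pt c (j%:R / 2 ^+ n)))
    (iota (pt c' (j%:R / 2 ^+ n))) <= 3^-1 / 2 ^+ n.
  move=> hj; have -> : 3^-1 / 2 ^+ n = c' - c by rewrite /c'; ring.
  apply: mdist_horizontal => // z /andP[cz zc'].
  apply: (grid_in_domain _ n l) => //; rewrite ger0_norm ?subr_ge0 //.
  rewrite (@le_lt_trans _ _ (3^-1 / 2 ^+ n)) ?lerBlDl //.
  by rewrite ltr_pM2r ?invr_gt0 //; lra.
have up : mdist (iota (pt c' (i%:R / 2 ^+ n)))
    (iota (pt c' (i.+1%:R / 2 ^+ n))) <= 1 / 2 ^+ n.
  have -> : 1 / 2 ^+ n = i.+1%:R / 2 ^+ n - i%:R / 2 ^+ n :> R.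
    by rewrite -natr1; ring.
  apply: mdist_vertical.
    by rewrite ler_pM2r ?invr_gt0 // ler_nat.
  move=> z /andP[iz zi]; apply: third_line_in_domain => //.
  rewrite (le_trans _ iz) ?divr_ge0 ?ler0n ?(ltW n0) //=.
  by rewrite (le_trans zi) // ler_pdivrMr // mul1r -natrX ler_nat.
have h1 := side _ (ltnW hi); have h2 := side _ hi.
have h3 := metric_triangle (iota (pt c (i%:R / 2 ^+ n)))
  (iota (pt c' (i%:R / 2 ^+ n))) (iota (pt c (i.+1%:R / 2 ^+ n))).
have h4 := metric_triangle (iota (pt c' (i%:R / 2 ^+ n)))
  (iota (pt c' (i.+1%:R / 2 ^+ n))) (iota (pt c (i.+1%:R / 2 ^+ n))).
rewrite metric_sym in h2.
have i0 : 0 < (2 ^+ n)^-1 :> R by rewrite invr_gt0.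
lra.
Qed.

(** By the intermediate value theorem a path crosses the line of the slit, and it does so above or
    below the slit. Both the way there and the way back then cover a height of more than half the
    slit. *)
Lemma mdist_across_slit (n l k : nat) (r : R) :
  (1 <= n)%N -> (l < 2 ^ n)%N -> (k < 2 ^ n)%N -> 0 < r ->
  let pl := pt (dyadic_center n l - r) (dyadic_center n k) in
  let pr := pt (dyadic_center n l + r) (dyadic_center n k) in
  slit_domain a pl -> slit_domain a pr ->
  a n / 2 ^+ n.+1 <= mdist (iota pl) (iota pr).
Proof.
move=> n1 ln kn r0 pl pr Spl Spr; rewrite -lee_fin iota_dist //.
apply: le_ereal_inf_tmp => _ [gamma [gc g0 g1 gS] <-].
have xc : {within `[0, 1], continuous (fun t : R => xcoord (gamma t))}.
  move=> t; apply: continuous_comp; first exact: gc.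
  exact: coord_continuous.
have xmid : Num.min (xcoord (gamma 0)) (xcoord (gamma 1)) <= dyadic_center n l
    <= Num.max (xcoord (gamma 0)) (xcoord (gamma 1)).
  rewrite g0 g1 !xcoord_pt ge_min le_max; apply/andP; split;
    apply/orP; [left|right]; lra.
have [t] := IVT ler01 xc xmid; rewrite /= in_itv /= => /andP[t0 t1] gt.
(* The crossing time is interior because the endpoints are at distance [r > 0] from the line. *)
have t01 : 0 < t < 1.
  rewrite !lt_neqAle t0 t1 !andbT; apply/andP; split; apply/eqP => te.
    by move: gt; rewrite -te g0 xcoord_pt; lra.
  by move: gt; rewrite te g1 xcoord_pt; lra.
apply: le_trans (curve_length_ge_via _ _ _ _ t01 g0 g1); rewrite lee_fin.
have : (a n / 2 ^+ n.+1) / 2 < `|ycoord (gamma t) - dyadic_center n k|.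
  rewrite ltNge; apply/negP => h; have [|_ hS] := gS t; first by rewrite t0 t1.
  exact: (hS n l k).
have := ycoord_le_eucl_dist pl (gamma t).
have := ycoord_le_eucl_dist (gamma t) pr.
rewrite !ycoord_pt [X in X <= _ -> _]distrC.
rewrite [`|dyadic_center n k - _|]distrC; lra.
Qed.

End carpet_metric.

(** Turns the quadratic gain of the parallelogram law into a linear one: the hypothesis yields
    [X^2 <= (2 g h)^2 (U^2 - c^2 / 16)], and [c^2 / 16 = 6 C lambda >= 2 U lambda] because
    [U <= 3 C]. *)
Lemma hinge_shortening {R : realType} (c C K delta U g h X lambda : R) :
  0 < c -> c <= C -> 0 < h -> (8 * 12) * C * lambda = c ^+ 2 ->
  (12 * 32) * C ^+ 2 < delta * K * c ^+ 2 ->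
  delta * K / 4 < g -> g <= delta * K / 4 + 1 -> 0 < U -> U <= 3 * C -> 0 <= X ->
  X ^+ 2 <= 4 * (U * h * g) ^+ 2 - (c * (delta * K * h / 2) - C * h) ^+ 2 ->
  X <= 2 * g * h * (U - lambda).
Proof.
move=> c0 cC h0 hl hK g1 g2 U0 UC X0 hX.
have C0 : 0 < C by lra.
have l0 : 0 < lambda.
  by rewrite -(pmulr_rgt0 _ (_ : 0 < (8 * 12) * C)) ?hl ?exprn_gt0 // mulr_gt0.
set E := delta * K in hK g1 g2 hX; clearbody E.
have Epos : 0 < E.
  rewrite -(pmulr_lgt0 _ (_ : 0 < c ^+ 2)) ?exprn_gt0 // (le_lt_trans _ hK) //.
  by rewrite mulr_ge0 // sqr_ge0.
have EC : (12 * 32) * C < E * c.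
  rewrite -(ltr_pM2r C0).
  have : 0 <= E * c * (C - c) by rewrite !mulr_ge0 ?subr_ge0 ?(ltW Epos) ?(ltW c0).
  lra.
have E0 : (12 * 32) < E.
  rewrite -(ltr_pM2r C0).
  have : 0 <= E * (C - c) by rewrite mulr_ge0 ?subr_ge0 ?(ltW Epos).
  lra.
have g0 : 0 < g by lra.
(* As [g] is about [E / 4], the left side is about a quarter of [c * E * h / 2]; the remainder
   absorbs [C * h] because [E * c] exceeds [384 * C]. *)
have bend : c * g / 2 * h <= c * (E * h / 2) - C * h.
  have : 0 <= (c * h) * (E / 4 + 1 - g) by rewrite !mulr_ge0 ?subr_ge0 // ?(ltW c0) ?(ltW h0).
  have : 0 <= h * (E * c - (12 * 32) * C) by rewrite mulr_ge0 ?subr_ge0 ?(ltW h0) // ltW.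
  have : 0 <= h * (C - c) by rewrite mulr_ge0 ?subr_ge0 ?(ltW h0).
  have : 0 <= c * h by rewrite mulr_ge0 ?(ltW c0) ?(ltW h0).
  lra.
have hX1 : X ^+ 2 <= (2 * g * h) ^+ 2 * (U ^+ 2 - c ^+ 2 / 16).
  have : (c * g / 2 * h) ^+ 2 <= (c * (E * h / 2) - C * h) ^+ 2.
    have b0 : 0 <= c * g / 2 * h by rewrite !mulr_ge0 ?(ltW c0) ?(ltW g0) ?(ltW h0).
    by rewrite ler_pXn2r // nnegrE // (le_trans b0).
  by move=> b2; lra.
have gh0 : 0 < 2 * g * h by rewrite !mulr_gt0.
have U2 : c ^+ 2 / 16 <= U ^+ 2.
  rewrite -subr_ge0 -(pmulr_rge0 _ (_ : 0 < (2 * g * h) ^+ 2)) ?exprn_gt0 //.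
  by rewrite (le_trans _ hX1) // sqr_ge0.
(* From [6 * C * lambda = c^2 / 16 <= U^2 <= 3 * C * U]; the right side is thus nonnegative and
   squares can be compared. *)
have Ul : lambda <= U by nra.
have rhs0 : 0 <= 2 * g * h * (U - lambda).
  by rewrite mulr_ge0 ?subr_ge0 // ltW.
rewrite -(@ler_pXn2r _ 2) ?nnegrE //; apply: (le_trans hX1); rewrite [leRHS]exprMn ler_pM2l ?exprn_gt0 //; nra.
Qed.

(** * Growth of the stretch under refinement *)

Section stretch.
Context {R : realType} {a : nat -> R} {M : metricType R} {iota : 'rV[R]_2 -> M}.
Context (a_bounds : forall n : nat, (1 <= n)%N -> 0 < a n < 1).
Context (iota_dist : forall p q, slit_domain a p -> slit_domain a q ->
  (mdist (iota p) (iota q))%:E = path_dist (slit_domain a) p q).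
Context {N : nat} {f : M -> 'rV[R]_N} {c0 C : R} (c0_gt0 : 0 < c0)
  (c0_le_C : c0 <= C).
Context (f_bilip : forall x y : M,
  c0 * mdist x y <= eucl_dist (f x) (f y) <= C * mdist x y).

Let F (x y : R) := f (iota (pt x y)).

Let C_gt0 : 0 < C. Proof. exact: lt_le_trans c0_le_C. Qed.

Let f_lip x y : enorm (f x - f y) <= C * mdist x y.
Proof. by have /andP[_] := f_bilip x y; rewrite eucl_dist_enorm. Qed.

Let f_colip x y : c0 * mdist x y <= enorm (f x - f y).
Proof. by have /andP[+ _] := f_bilip x y; rewrite eucl_dist_enorm. Qed.

(** The square is existentially quantified because refinement gives no control over which finer pair
    is stretched. *)
Definition edge_stretched (V : R) (n : nat) : Prop :=
  exists l i, [/\ (l < 2 ^ n)%N, (i < 2 ^ n)%N &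
    V / 2 ^+ n <= enorm (F (dyadic_center n l) (i.+1%:R / 2 ^+ n) -
                         F (dyadic_center n l) (i%:R / 2 ^+ n))].

Lemma edge_stretched_le (V : R) (n : nat) : edge_stretched V n -> V <= 2 * C.
Proof.
move=> [l [i [ln hi hV]]]; have n0 := pow2_gt0 (R := R) n.
rewrite -(ler_pM2r (_ : 0 < (2 ^+ n)^-1)) ?invr_gt0 //.
apply: (le_trans hV); apply: (le_trans (f_lip _ _)).
have -> : 2 * C * (2 ^+ n)^-1 = C * (2 / 2 ^+ n) by ring.
rewrite ler_pM2l // metric_sym; exact: (mdist_edge_midpoints a_bounds iota_dist).
Qed.

Lemma subgrid_le (n k i j : nat) : (i < 2 ^ n)%N -> (j <= 2 ^ k)%N ->
  (i * 2 ^ k + j <= 2 ^ (n + k))%N.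
Proof.
move=> hi hj; rewrite expnD; apply: (@leq_trans (i.+1 * 2 ^ k)).
  by rewrite mulSnr leq_add2l.
by rewrite leq_mul2r hi orbT.
Qed.

(* The slit of a dyadic square spans the grid heights of index closer to 2^m
   than a_n 2^(m+1) / 4, counted from the bottom side. *)
Lemma grid_off_slit (n m i j g k : nat) : (1 <= n)%N ->
  (a n * 2 ^+ m.+1 / 4 < g%:R)%R -> (g <= 2 ^ m)%N -> (j <= 2 ^ m.+1)%N ->
  (j + g <= 2 ^ m)%N || (2 ^ m + g <= j)%N ->
  (a n / 2 ^+ n.+1) / 2 <
    `|(i * 2 ^ m.+1 + j)%N%:R / 2 ^+ (n + m.+1) - dyadic_center n k| :> R.
Proof.
move=> n1 hg gm jm hj; have n0 := pow2_gt0 (R := R) n.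
have m0 := pow2_gt0 (R := R) m.
have nm0 := pow2_gt0 (R := R) (n + m.+1).
have -> : a n / 2 ^+ n.+1 / 2 = (a n * 2 ^+ m.+1 / 4) / 2 ^+ (n + m.+1).
  by rewrite exprD !exprS; field; lra.
have -> : (i * 2 ^ m.+1 + j)%N%:R / 2 ^+ (n + m.+1) - dyadic_center n k =
    (i%:R * (2 * 2 ^+ m) + j%:R - (k%:R * (2 * 2 ^+ m) + 2 ^+ m))
      / 2 ^+ (n + m.+1) :> R.
  by rewrite /dyadic_center natrD natrM natrX exprD !exprS; field; lra.
rewrite normrM [X in _ < _ * X]gtr0_norm ?invr_gt0 //.
rewrite ltr_pM2r ?invr_gt0 //; apply: (lt_le_trans hg).
have -> : 2 * 2 ^+ m = (2 * 2 ^ m)%N%:R :> R by rewrite natrM natrX.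
rewrite -natrX -!natrM -!natrD ler_normr.
move: jm hj; rewrite expnS => jm hj.
have [h|h] : (i * (2 * 2 ^ m) + j + g <= k * (2 * 2 ^ m) + 2 ^ m)%N \/
   (k * (2 * 2 ^ m) + 2 ^ m + g <= i * (2 * 2 ^ m) + j)%N.
  (* If [i <> k], the point lies in another square of the column, at least [2 ^ m >= g] index units
     from the centre of square [k]. *)
  case: (ltngtP i k) => [ik|ki|->]; last by case/orP: hj => ?; lia.
    by left; have := leq_mul ik (leqnn (2 * 2 ^ m)); lia.
  by right; have := leq_mul ki (leqnn (2 * 2 ^ m)); lia.
- by apply/orP; right; move: h; rewrite -(ler_nat R) (natrD _ (_ + _)%N g); lra.
- by apply/orP; left; move: h; rewrite -(ler_nat R) (natrD _ (_ + _)%N g); lra.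
Qed.

(* With lambda = c0^2 / (96 C), the detour forced by the slit costs the chain a
   length 2 g lambda in units of the finer scale, where g > a_n K / 4, while the
   horizontal jumps between AB and the chain cost only C; the excess is shared
   among the K = 2^(m+1) pieces, whence a gain a_n lambda / 4 per piece. *)
Lemma edge_stretched_refine (n m : nat) (V : R) : (1 <= n)%N -> 0 <= V ->
  (12 * 32) * C ^+ 2 < a n * 2 ^+ m.+1 * c0 ^+ 2 ->
  edge_stretched V n ->
  edge_stretched (V + a n * c0 ^+ 2 / ((12 * 32) * C)) (n + m.+1).
Proof.
move=> n1 V0 hK hV; have V2C := edge_stretched_le _ _ hV.
have {hV} [l [i [ln hi hV]]] := hV.
have /andP[an0 an1] := a_bounds n n1.
set theta := a n * c0 ^+ 2 / ((12 * 32) * C); set U := V + theta.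
set n' := (n + m.+1)%N; set K : R := 2 ^+ m.+1 in hK.
(* Otherwise every piece of the two side chains has image length at most [U * h], with [h] the fine
   scale. *)
apply: contrapT => notU.
have {}notU l' i' : (l' < 2 ^ n')%N -> (i' < 2 ^ n')%N ->
    enorm (F (dyadic_center n' l') (i'.+1%:R / 2 ^+ n') -
           F (dyadic_center n' l') (i'%:R / 2 ^+ n')) <= U / 2 ^+ n'.
  move=> hl hi'; rewrite leNgt; apply/negP => h; apply: notU.
  by exists l', i'; split=> //; rewrite ltW.
pose h : R := (2 ^+ n')^-1.
have h0 : 0 < h by rewrite invr_gt0 pow2_gt0.
pose lambda := c0 ^+ 2 / ((8 * 12) * C).
have hl : (8 * 12) * C * lambda = c0 ^+ 2.
  by rewrite /lambda mulrC divfK // gt_eqF // mulr_gt0.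
have C0 := C_gt0.
have htheta : theta = a n * lambda / 4 by rewrite /theta /lambda; field; lra.
have K0 : 0 < K by exact: pow2_gt0.
(* In units of [h] the half-length of the slit is [a n * K / 4]; [g] is the least integer beyond
   it. *)
pose g := (Num.truncn (a n * K / 4)).+1.
have aK0 : 0 <= a n * K / 4 by rewrite !mulr_ge0 ?(ltW an0) ?(ltW K0).
have g1 : a n * K / 4 < g%:R by exact: truncnS_gt.
have g2 : g%:R <= a n * K / 4 + 1.
  by rewrite /g -natr1 lerD2r; have /andP[] := truncn_itv aK0.
have cC2 : c0 ^+ 2 <= C ^+ 2 by rewrite ler_pXn2r // nnegrE ltW.
have lambdaC : lambda <= C / (8 * 12).
  rewrite -(ler_pM2l (_ : 0 < (8 * 12) * C)) ?mulr_gt0 // hl; lra.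
have lambda0 : 0 < lambda by rewrite divr_gt0 ?exprn_gt0 ?mulr_gt0.
have aK_big : (12 * 32) < a n * K.
  rewrite -(@ltr_pM2r _ (c0 ^+ 2)) ?exprn_gt0 //; apply: le_lt_trans hK; lra.
have gm : (g <= 2 ^ m)%N.
  rewrite -(ler_nat R) natrX; have : a n * K <= K by rewrite ger_pMl // ltW.
  by move: g2 aK_big; rewrite /K exprS; lra.
have U0 : 0 < U.
  by rewrite /U htheta ltr_wpDl // divr_gt0 // mulr_gt0.
have U3C : U <= 3 * C.
  have : a n * lambda <= lambda by rewrite ger_pMl // ltW.
  by rewrite /U htheta; lra.
(* [true] is the right chain and [false] the left one; [j] counts fine heights from the bottom side
   of the square. *)
pose side (b : bool) : R := if b then 1 else -1.
pose T b j := F (dyadic_center n l + side b * (2^-1 / 2 ^+ n'))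
                ((i * 2 ^ m.+1 + j)%N%:R / 2 ^+ n').
have hstep b j : (j < 2 ^ m.+1)%N -> enorm (T b j.+1 - T b j) <= U * h.
  move=> hj; rewrite /T /side center_col [(_ + j.+1)%N]addnS; apply: notU.
    exact: center_col_lt.
  by rewrite -addnS; exact: subgrid_le.
have hchain b j j' : (j <= j')%N -> (j' <= 2 ^ m.+1)%N ->
    enorm (T b j' - T b j) <= U * h * (j'%:R - j%:R).
  move=> jj' hj'; rewrite -natrB //; apply: enorm_sum => // j1 /andP[_ h1].
  by apply: hstep; exact: leq_trans hj'.
have nn' : (n < n')%N by rewrite /n' addnS ltnS leq_addr.
have hcross j x x' : (j <= 2 ^ m.+1)%N ->
    (j + g <= 2 ^ m)%N || (2 ^ m + g <= j)%N ->
    dyadic_center n l - 2^-1 / 2 ^+ n' <= x -> x <= x' ->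
    x' <= dyadic_center n l + 2^-1 / 2 ^+ n' ->
    enorm (F x ((i * 2 ^ m.+1 + j)%N%:R / 2 ^+ n') -
           F x' ((i * 2 ^ m.+1 + j)%N%:R / 2 ^+ n')) <= C * (x' - x).
  move=> hj hjg h1 h2 h3; apply: (le_trans (f_lip _ _)); rewrite ler_pM2l //.
  apply: (mdist_crossing a_bounds iota_dist n n' l) => //.
    exact: subgrid_le.
  by move=> k; apply: (grid_off_slit n m i j g).
have hLR j : (j <= 2 ^ m.+1)%N -> (j + g <= 2 ^ m)%N || (2 ^ m + g <= j)%N ->
    enorm (T false j - T true j) <= C * h.
  move=> hj hjg.
  have -> : C * h = C * ((dyadic_center n l + side true * (2^-1 / 2 ^+ n')) -
      (dyadic_center n l + side false * (2^-1 / 2 ^+ n'))).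
    by rewrite /side /h; field; rewrite gt_eqF // pow2_gt0.
  by apply: hcross => //; rewrite /side -/h; lra.
pose E j := F (dyadic_center n l) ((i * 2 ^ m.+1 + j)%N%:R / 2 ^+ n').
have hend b j : (j <= 2 ^ m.+1)%N -> (j + g <= 2 ^ m)%N || (2 ^ m + g <= j)%N ->
    enorm (E j - T b j) <= C * h / 2.
  move=> hj hjg; case: b.
    have -> : C * h / 2 = C * ((dyadic_center n l + side true * (2^-1 / 2 ^+ n'))
        - dyadic_center n l) by rewrite /side /h; ring.
    by apply: hcross => //; rewrite /side -/h; lra.
  rewrite -enormN opprB.
  have -> : C * h / 2 = C * (dyadic_center n l -
      (dyadic_center n l + side false * (2^-1 / 2 ^+ n'))).
    by rewrite /side /h; ring.
  by apply: hcross => //; rewrite /side -/h; lra.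
have hslit : c0 * (a n * K * h / 2) <= enorm (T false (2 ^ m)%N - T true (2 ^ m)%N).
  (* Index [2 ^ m] is the height of the centre of the slit, where the two chains are separated by at
     least the slit length [a n * K * h / 2]. *)
  have hmid : (i * 2 ^ m.+1 + 2 ^ m)%N%:R / 2 ^+ n' = dyadic_center n i :> R.
    rewrite /n' /dyadic_center natrD natrM !natrX exprD !exprS.
    by field; rewrite !gt_eqF // pow2_gt0.
  have hdom b : slit_domain a (pt (dyadic_center n l + side b * (2^-1 / 2 ^+ n'))
      (dyadic_center n i)).
    rewrite /side center_col -hmid.
    apply: (grid_in_domain _ n' ((2 * l + 1) * 2 ^ m - ~~ b)%N) => //.
    - by move=> k /a_bounds /andP[].
    - exact: center_col_lt.
    - by apply: subgrid_le => //; rewrite leq_exp2l.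
    - by rewrite subrr normr0 divr_gt0 // pow2_gt0.
  rewrite /T hmid; apply: le_trans (f_colip _ _); rewrite ler_pM2l //.
  have hp := hdom false; have hq := hdom true.
  rewrite /side mulN1r in hp *; rewrite /side mul1r in hq *.
  have r0 : 0 < 2^-1 / 2 ^+ n' :> R by rewrite divr_gt0 // pow2_gt0.
  apply: le_trans (mdist_across_slit iota_dist _ _ _ _ n1 ln hi r0 hp hq).
  rewrite le_eqVlt; apply/orP; left; apply/eqP; rewrite /K /h /n' exprD !exprS.
  by field; rewrite !gt_eqF // pow2_gt0.
have aKc : (12 * 32) * C < a n * K * c0.
  rewrite -(ltr_pM2r C0).
  have : 0 <= a n * K * c0 * (C - c0).
    by rewrite !mulr_ge0 ?subr_ge0 // ltW.
  by move: hK; lra.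
have he : C * h <= c0 * (a n * K * h / 2).
  by have : (12 * 32) * C * h < a n * K * c0 * h; rewrite ?ltr_pM2r //; nra.
have mm : (2 ^ m <= 2 ^ m.+1)%N by rewrite leq_exp2l.
have mg2 : (2 ^ m + g <= 2 ^ m.+1)%N by rewrite expnS mul2n -addnn leq_add2l.
have mg1 : (2 ^ m - g <= 2 ^ m)%N by rewrite leq_subr.
have arm b j j' : (j <= j')%N -> (j' <= 2 ^ m.+1)%N -> (j' - j = g)%N ->
    enorm (T b j' - T b j) <= U * h * g%:R.
  by move=> h1 h2 h3; rewrite -h3 natrB // hchain.
(* The hinges have their middles at the centre of the slit and their ends [g] steps above and below,
   where the chains can be joined at cost [C * h]. *)
have [b hb] : exists b, enorm (T b (2 ^ m + g)%N - T b (2 ^ m - g)%N) ^+ 2 <=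
    4 * (U * h * g%:R) ^+ 2 - (c0 * (a n * K * h / 2) - C * h) ^+ 2.
  have : _ \/ _ := double_hinge (U * h * g%:R) (c0 * (a n * K * h / 2)) (C * h)
    (T false (2 ^ m + g)%N) (T false (2 ^ m)%N) (T false (2 ^ m - g)%N)
    (T true (2 ^ m + g)%N) (T true (2 ^ m)%N) (T true (2 ^ m - g)%N)
    _ _ _ _ _ _ hslit he.
  case; [| | | | | |by exists false|by exists true].
  - by apply: arm; rewrite ?subKn // (leq_trans mg1).
  - by apply: arm; rewrite ?leq_addr // addKn.
  - by apply: arm; rewrite ?subKn // (leq_trans mg1).
  - by apply: arm; rewrite ?leq_addr // addKn.
  - by apply: hLR => //; rewrite leqnn orbT.
  - by apply: hLR; rewrite ?subnK ?leqnn // (leq_trans mg1).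
have short : enorm (T b (2 ^ m + g)%N - T b (2 ^ m - g)%N) <=
    2 * g%:R * h * (U - lambda).
  exact: hinge_shortening c0_gt0 c0_le_C h0 hl hK g1 g2 U0 U3C (enorm_ge0 _) hb.
have hE0 : E 0%N = F (dyadic_center n l) (i%:R / 2 ^+ n).
  rewrite /E addn0 natrM natrX /n' exprD; congr F.
  by field; rewrite !gt_eqF // pow2_gt0.
have hEK : E (2 ^ m.+1)%N = F (dyadic_center n l) (i.+1%:R / 2 ^+ n).
  rewrite /E -mulSnr natrM natrX /n' exprD; congr F.
  by field; rewrite !gt_eqF // pow2_gt0.
have hK0 : (0 + g <= 2 ^ m)%N || (2 ^ m + g <= 0)%N by rewrite gm.
have hKK : (2 ^ m.+1 + g <= 2 ^ m)%N || (2 ^ m + g <= 2 ^ m.+1)%N.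
  by rewrite mg2 orbT.
have e1 := hend b _ (leqnn _) hKK; have e2 := hend b _ (leq0n _) hK0.
have e3 := hchain b _ _ mg2 (leqnn _).
have e4 := hchain b _ _ (leq0n (2 ^ m - g)%N) (leq_trans mg1 mm).
rewrite -hE0 -hEK in hV; rewrite -enormN opprB in e2.
(* Go from the bottom of AB across to chain [b], up to the hinge, along its shortened base, up to
   the top, and back across. *)
have : V / 2 ^+ n <= C * h / 2 + (U * h * ((2 ^ m.+1)%N%:R - (2 ^ m + g)%N%:R) +
    (2 * g%:R * h * (U - lambda) + (U * h * ((2 ^ m - g)%N%:R - 0) + C * h / 2))).
  apply: (le_trans hV).
  have -> : E (2 ^ m.+1)%N - E 0%N = (E (2 ^ m.+1)%N - T b (2 ^ m.+1)%N) +
     ((T b (2 ^ m.+1)%N - T b (2 ^ m + g)%N) +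
     ((T b (2 ^ m + g)%N - T b (2 ^ m - g)%N) + ((T b (2 ^ m - g)%N - T b 0%N) +
     (T b 0%N - E 0%N)))).
    by rewrite !addrA !subrK.
  do 4!(apply: (le_trans (enormD _ _)); apply: lerD => //).
have -> : V / 2 ^+ n = V * K * h.
  by rewrite /h /n' exprD /K; field; rewrite !gt_eqF // pow2_gt0.
rewrite natrB // natrD !natrX subr0 -/K.
have -> : 2 ^+ m = K / 2 by rewrite /K exprS; field.
rewrite /U htheta => bound.
have {}bound : a n * K * lambda / 4 * h <= C * h.
  have lh0 : 0 < lambda * h by rewrite mulr_gt0.
  have : 0 <= (g%:R - a n * K / 4) * (lambda * h).
    by rewrite mulr_ge0 ?(ltW lh0) // subr_ge0 ltW.
  lra.
(* The saving [2 g lambda] exceeds [a n * K * lambda / 2], half of which is spent on [theta * K].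
   The other half exceeds the crossing cost [C] by the assumption on [K], since
   [12 * 32 = 4 * 96]. *)
move: bound; rewrite ler_pM2r //; apply/negP; rewrite -ltNge.
rewrite -(ltr_pM2l (_ : 0 < (8 * 12) * C)) ?mulr_gt0 //.
have -> : (8 * 12) * C * (a n * K * lambda / 4) = a n * K * ((8 * 12) * C * lambda) / 4 by ring.
rewrite hl; lra.
Qed.

(** * Iterating the refinement over the levels *)

Lemma edge_stretched_weaken (V V' : R) (n : nat) : V' <= V ->
  edge_stretched V n -> edge_stretched V' n.
Proof.
move=> V'V [l [i [hl hi hV]]]; exists l, i; split=> //.
by rewrite (le_trans _ hV) // ler_pM2r ?invr_gt0 ?pow2_gt0.
Qed.

Context (a_noninc : forall m n : nat, (1 <= m)%N -> (m <= n)%N -> a n <= a m).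

(** Start at level 1 with stretch 0. By monotonicity every level [k <= n] has [a k >= a n], so the
    same [m] works at each step and each gain is at least the one computed from [a n]. *)
Lemma edge_stretched_iter (n m j : nat) :
  12 * 32 * C ^+ 2 < a n * 2 ^+ m.+1 * c0 ^+ 2 -> (1 + j * m.+1 <= n)%N ->
  edge_stretched (j%:R * (a n * c0 ^+ 2 / (12 * 32 * C))) (1 + j * m.+1).
Proof.
move=> hm; elim: j => [|j IHj] hj.
  by exists 0%N, 0%N; split=> //; rewrite !mul0r enorm_ge0.
set k := (1 + j * m.+1)%N in IHj.
have kn : (k <= n)%N by rewrite (leq_trans _ hj) // leq_add2l leq_mul2r leqnSn orbT.
have k1 : (1 <= k)%N by rewrite /k add1n.
have n1 : (1 <= n)%N := leq_trans k1 kn.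
have ank := a_noninc k n k1 kn; have /andP[an0 _] := a_bounds n n1.
have C384 : 0 < (12 * 32 * C)^-1 by rewrite invr_gt0 !mulr_gt0.
have -> : (1 + j.+1 * m.+1)%N = (k + m.+1)%N by rewrite mulSnr addnA.
apply: (@edge_stretched_weaken
  (j%:R * (a n * c0 ^+ 2 / (12 * 32 * C)) + a k * c0 ^+ 2 / (12 * 32 * C))).
  by rewrite -natr1 mulrDl mul1r lerD2l ler_pM2r // ler_pM2r ?exprn_gt0.
apply: edge_stretched_refine => //; last exact: IHj.
  by rewrite !mulr_ge0 ?invr_ge0 ?mulr_ge0 ?ler0n ?sqr_ge0 ?ltW.
by apply: (lt_le_trans hm); rewrite ler_pM2r ?exprn_gt0 // ler_pM2r.
Qed.

Lemma iteration_bound (n m j : nat) :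
  12 * 32 * C ^+ 2 < a n * 2 ^+ m.+1 * c0 ^+ 2 -> (1 + j * m.+1 <= n)%N ->
  j%:R * a n * c0 ^+ 2 <= 2 * (12 * 32 * C ^+ 2).
Proof.
move=> hm hj; have C0 := C_gt0.
have := edge_stretched_le _ _ (edge_stretched_iter n m j hm hj).
rewrite !mulrA ler_pdivrMr ?mulr_gt0 // => h; apply: (le_trans h).
by rewrite le_eqVlt; apply/orP; left; apply/eqP; ring.
Qed.

(* A height b^q slit is resolved by K = 2^(q t) subdivisions with t of order
   1/b only, so the levels 1, ..., n contain at least n b / (q const) steps. *)
Lemma level_bound (q : nat) : (0 < q)%N -> exists2 B : R, 0 < B &
  forall n (b : R), (1 <= n)%N -> 0 < b -> b ^+ q = a n -> n%:R * b ^+ q.+1 <= B.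
Proof.
move=> q0; have C0 := C_gt0; have c2 : 0 < c0 ^+ 2 by rewrite exprn_gt0.
(* The added 1 gives both [T >= 1], needed for [T <= (b * 2 ^+ t) ^+ q], and the strict inequality
   required of [m]. *)
pose T := 12 * 32 * C ^+ 2 / c0 ^+ 2 + 1.
have T1 : 1 <= T.
  by rewrite /T lerDr divr_ge0 ?(ltW c2) // mulr_ge0 // sqr_ge0.
have hT : 12 * 32 * C ^+ 2 = (T - 1) * c0 ^+ 2.
  by rewrite /T addrK divfK // gt_eqF.
clearbody T.
have q0' : 0 < q%:R :> R by rewrite ltr0n.
(* The factors bound [j * a n + a n], [q] and [t * b], where [n <= (j + 1) * q * t]. *)
exists ((2 * T + 1) * q%:R * (T + 1)).
  by rewrite !mulr_gt0 // addr_gt0 // ?mulr_gt0 // (lt_le_trans ltr01).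
move=> n b n1 b0 hb; have /andP[an0 an1] := a_bounds n n1.
have b1 : b < 1.
  by rewrite ltNge; apply/negP => b1; move: an1; rewrite -hb ltNge exprn_ege1.
have T0 : 0 < T := lt_le_trans ltr01 T1.
pose t := (Num.truncn (T / b)).+1.
have Tb0 : 0 <= T / b by rewrite divr_ge0 // ltW.
have t1 : T / b < t%:R by exact: truncnS_gt.
have t2 : t%:R * b <= T + 1.
  have : t%:R <= T / b + 1.
    by rewrite /t -natr1 lerD2r; have /andP[] := truncn_itv Tb0.
  move=> /(ler_wpM2r (ltW b0)); rewrite mulrDl mul1r divfK ?gt_eqF // => h.
  by rewrite (le_trans h) // lerD2l ltW.
have t0 : (0 < t)%N by [].
clearbody t.
have qt0 : (0 < q * t)%N by rewrite muln_gt0 q0.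
have hm : 12 * 32 * C ^+ 2 < a n * 2 ^+ (q * t).-1.+1 * c0 ^+ 2.
  rewrite prednK // hT ltr_pM2r // mulnC exprM -hb -exprMn.
  have bt : T < b * 2 ^+ t.
    rewrite mulrC -ltr_pdivrMr // (lt_trans t1) // -natrX ltr_nat.
    exact: ltn_expl.
  have : T <= (b * 2 ^+ t) ^+ q.
    rewrite (le_trans (ltW bt)) // -{1}[b * _]expr1 ler_weXn2l //.
    by rewrite (le_trans T1) // ltW.
  lra.
(* The [n.-1] levels after level 1 are grouped into steps of [q * t] levels each. *)
pose j := (n.-1 %/ (q * t))%N.
have hj : (1 + j * (q * t).-1.+1 <= n)%N.
  by rewrite prednK // add1n -(prednK n1) ltnS leq_divM.
have hjb := iteration_bound n _ j hm hj.
have {}hjb : j%:R * a n <= 2 * T.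
  rewrite -(ler_pM2r c2) (le_trans hjb) // hT.
  have : 0 <= c0 ^+ 2 by exact: ltW.
  lra.
have nj : n%:R <= (j%:R + 1) * (q%:R * t%:R) :> R.
  rewrite natr1 -!natrM ler_nat -{1}(prednK n1).
  by rewrite {1}(divn_eq n.-1 (q * t)) -/j mulSnr -addnS leq_add2l ltn_mod.
have bq0 : 0 < b ^+ q.+1 by rewrite exprn_gt0.
apply: (le_trans (ler_wpM2r (ltW bq0) nj)).
have -> : (j%:R + 1) * (q%:R * t%:R) * b ^+ q.+1 =
    (j%:R * a n + a n) * q%:R * (t%:R * b) by rewrite -hb exprS; ring.
have ja0 : 0 <= j%:R * a n + a n by rewrite addr_ge0 ?mulr_ge0 ?ler0n ?ltW.
apply: ler_pM => //.
- by rewrite mulr_ge0 ?ler0n.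
- by rewrite mulr_ge0 ?ler0n ?(ltW b0).
- by rewrite ler_pM2r // lerD // ltW.
Qed.

End stretch.

(** * Cauchy condensation and the conclusion *)

Lemma cauchy_condensation {R : realType} (u : nat -> R) (A rho : R) :
  (forall n, (1 <= n)%N -> 0 <= u n) ->
  (forall m n, (1 <= m)%N -> (m <= n)%N -> u n <= u m) ->
  0 <= A -> 0 <= rho < 1 ->
  (forall i, 2 ^+ i * u (2 ^ i)%N <= A * rho ^+ i) ->
  (\sum_(1 <= n <oo) (u n)%:E < +oo)%E.
Proof.
move=> u0 u_noninc A0 /andP[rho0 rho1] hu.
(* Each block from [2 ^ i] to [2 ^ i.+1] is bounded by its length times its first term; the
   geometric sum is kept multiplied by [1 - rho] to make the induction linear. *)
have dyadic i : (\sum_(1 <= n < 2 ^ i) u n) * (1 - rho) <= A * (1 - rho ^+ i).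
  elim: i => [|i IHi]; first by rewrite big_geq // mul0r subrr mulr0.
  rewrite (big_cat_nat (n := (2 ^ i)%N)) /= ?expn_gt0 ?leq_exp2l // mulrDl.
  have block : \sum_(2 ^ i <= n < 2 ^ i.+1) u n <= A * rho ^+ i.
    apply: le_trans (hu i).
    have -> : 2 ^+ i * u (2 ^ i)%N = \sum_(2 ^ i <= n < 2 ^ i.+1) u (2 ^ i)%N.
      by rewrite sumr_const_nat expnS mul2n -addnn addnK -natrX mulr_natl.
    rewrite big_nat [leRHS]big_nat; apply: ler_sum => n /andP[hn _].
    by apply: u_noninc; rewrite // expn_gt0.
  have : (\sum_(2 ^ i <= n < 2 ^ i.+1) u n) * (1 - rho) <= A * rho ^+ i * (1 - rho).
    by rewrite ler_wpM2r // subr_ge0 ltW.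
  rewrite exprSr; lra.
have partial k : \sum_(1 <= n < k) u n <= A / (1 - rho).
  rewrite ler_pdivlMr ?subr_gt0 //.
  have : A * (1 - rho ^+ k) <= A.
    by rewrite -[leRHS]mulr1 ler_wpM2l // gerBl exprn_ge0.
  apply: le_trans; apply: le_trans (dyadic k).
  rewrite ler_pM2r ?subr_gt0 //.
  have [k0|k_gt0] := posnP k; first by rewrite k0 big_geq.
  have k2k : (k <= 2 ^ k)%N by rewrite ltnW // ltn_expl.
  rewrite (big_cat_nat k_gt0 k2k) /= lerDl.
  rewrite big_nat sumr_ge0 // => n /andP[kn _].
  by rewrite u0 // (leq_trans k_gt0).
apply: (@le_lt_trans _ _ (A / (1 - rho))%:E); last by rewrite ltry.
apply: lime_le.
  by apply: is_cvg_nneseries => n n1 _; rewrite lee_fin u0.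
by apply: nearW => k; rewrite sumEFin lee_fin.
Qed.

Theorem theorem1p3 (R : realType) (a : nat -> R)
  (a_noninc : forall m n : nat, (1 <= m)%N -> (m <= n)%N -> a n <= a m)
  (a_bounds : forall n : nat, (1 <= n)%N -> 0 < a n < 1)
  (M : metricType R) (M_carpet : is_dyadic_slit_carpet a M)
  (M_embeds : exists (N : nat) (f : M -> 'rV[R]_N), bilipschitz_embedding f)
  (eps : R) (eps_gt0 : 0 < eps) :
  (\sum_(1 <= n <oo) (a n `^ (1 + eps))%:E < +oo)%E.
Proof.
case: M_carpet => iota [_ iota_dist _].
case: M_embeds => N [f [c0 [C [c0_gt0 c0_le_C f_bilip]]]].
(* With [1 / q < eps], taking [b] as the [q]-th root of [a n] gives [a n] to the power [1 + 1/q] at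
   most [B / n], a power form of the logarithmic bound. *)
pose q := (Num.truncn (eps^-1)).+1.
have q_eps : q%:R^-1 < eps.
  rewrite -[ltRHS]invrK ltf_pV2 ?posrE ?invr_gt0 ?ltr0n //.
  exact: truncnS_gt.
have q0 : (0 < q)%N by [].
clearbody q.
have q0' : 0 < q%:R^-1 :> R by rewrite invr_gt0 ltr0n.
have [B B0 hB] := level_bound a_bounds iota_dist c0_gt0 c0_le_C f_bilip a_noninc _ q0.
pose r : R := 1 + q%:R^-1.
have r0 : 0 < r by rewrite addr_gt0.
have {}hB n : (1 <= n)%N -> a n `^ r <= B / n%:R.
  move=> n1; have /andP[an0 _] := a_bounds n n1.
  rewrite ler_pdivlMr ?ltr0n // mulrC.
  have hb : (a n `^ q%:R^-1) ^+ q = a n.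
    by rewrite -powR_mulrn ?powR_ge0 // -powRrM mulVf ?powRr1 ?ltW // gt_eqF // ltr0n.
  have := hB n (a n `^ q%:R^-1) n1 (powR_gt0 _ an0) hb.
  rewrite exprSr hb /r powRD ?powRr1 ?(ltW an0) //.
  by rewrite (gt_eqF an0) implybT.
pose s := (1 + eps) / r.
have s1 : 1 < s by rewrite /s ltr_pdivlMr // mul1r /r; lra.
have a_s n : a n `^ (1 + eps) = (a n `^ r) `^ s.
  by rewrite -powRrM /s mulrCA divff ?mulr1 // gt_eqF.
(* Raising [B / n] to the power [s > 1] at [n = 2 ^ i] and multiplying by [2 ^ i] gives a geometric
   sequence of ratio [2] to the power [1 - s], which is below 1. *)
apply: (@cauchy_condensation _ (fun n => a n `^ (1 + eps)) (B `^ s) (2 `^ (1 - s))).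
- by move=> n _; exact: powR_ge0.
- move=> m n m1 mn; apply: ge0_ler_powR; rewrite ?nnegrE.
  + by rewrite addr_ge0 // ltW.
  + by have /andP[/ltW] := a_bounds n (leq_trans m1 mn).
  + by have /andP[/ltW] := a_bounds m m1.
  + exact: a_noninc.
- exact: powR_ge0.
- rewrite powR_ge0 /= -opprB powRN invf_lt1 ?powR_gt0 //.
  rewrite -[ltLHS](_ : 1 `^ (s - 1) = 1); last by rewrite powR1.
  apply: gt0_ltr_powR; rewrite ?nnegrE ?subr_gt0 //.
  by rewrite ltrDl.
move=> i; have p0 : 0 < 2 ^+ i :> R := pow2_gt0 i.
have -> : B `^ s * 2 `^ (1 - s) ^+ i = 2 ^+ i * (B / 2 ^+ i) `^ s.
  rewrite powRM ?invr_ge0 ?(ltW B0) ?(ltW p0) // mulrCA; congr (_ * _).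
  rewrite -powR_mulrn ?powR_ge0 // -powRrM mulrC powRrM powR_mulrn //.
  rewrite powRB; last by rewrite (gt_eqF p0) implybT.
  rewrite powRr1 ?(ltW p0) //; congr (_ * _).
  by rewrite -powRN -mulN1r powRrM powR_inv1 // ltW.
rewrite ler_pM2l // a_s; apply: ge0_ler_powR; rewrite ?nnegrE ?powR_ge0 //.
- by rewrite ltW // (lt_trans ltr01).
- by rewrite divr_ge0 // ltW.
- by rewrite -natrX hB // expn_gt0.
Qed.
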